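(* (1) Let $H$ be a simple graph with finite vertex set $V$, and let $\varphi$ be a finite sequence of local complementation operations (on simple graphs) applicable to $H$. Then $H\varphi=\pi(i(H)+X*Y)$ for some $X,Y\subseteq V$ with $X\subseteq Y$ (in particular, $i(H)+X*Y$ is defined). (2) Conversely, let $G$ be a graph (loops allowed) with finite vertex set $V$. If $G+X*Y$ is defined for some $X,Y\subseteq V$, then there is a finite sequence $\varphi$ of local complementation operations (on simple graphs) applicable to $\pi(G)$ such that $\pi(G)\varphi=\pi(G+X*Y)$.
   Context: Graphs are finite, undirected, without parallel edges, loops allowed; a graph $G$ with vertex set $V$ is identified with its adjacency matrix, a symmetric $V\times V$-matrix over $\mathbb{F}_2$ whose diagonal entry at $u$ is $1$ iff $u$ has a loop. A simple graph is an undirected graph without loops or parallel edges. Operations are written postfix and associate to the left. For a simple graph $H$, $i(H)$ is $H$ regarded as a graph having no loops. For a graph $G$, $\pi(G)$ is the simple graph obtained from $G$ by removing all loops. Local complementation on a simple graph $H$ at any vertex $u$, denoted $H*\{u\}$, complements the edges in the neighbourhood of $u$: for distinct neighbours $v,w$ of $u$, $\{v,w\}$ is an edge of $H*\{u\}$ iff it is not an edge of $H$; all other edges are unchanged. It is applicable at every vertex. Operations on graphs with loops allowed: the loop complementation $G+X$ ($X\subseteq V$) adds $1$ to each diagonal entry of the adjacency matrix indexed by an element of $X$. The pivot $G*X$ is defined iff $\det G[X]=1$ over $\mathbb{F}_2$, where $G[X]$ is the principal submatrix on $X$ and $\det G[\varnothing]=1$; then, writing $G=\begin{pmatrix} P &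 Q \\ R & S \end{pmatrix}$ with $P=G[X]$, $$G*X=\begin{pmatrix} P^{-1} & P^{-1} Q \\ R P^{-1} & S + R P^{-1} Q \end{pmatrix}.$$ Thus $G+X*Y=(G+X)*Y$ is defined iff $\det (G+X)[Y]=1$. *)

(* Defs.v *)
From HB Require Import structures.
From mathcomp Require Import all_boot all_order all_algebra.
Set Implicit Arguments.
Unset Strict Implicit.
Unset Printing Implicit Defensive.
Import GRing.Theory.
Local Open Scope ring_scope.

Section SimpleGraphs.
Variable V : finType.

Definition sgraph_axiom (e : {ffun V * V -> bool}) : bool :=
  [forall u, ~~ e (u, u)] && [forall u, forall v, e (u, v) == e (v, u)].

(* Edges are stored as a finfun with a boolean axiom, so that Leibniz equality
   of simple graphs is equality of edge sets. *)
Record sgraph := SGraph {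
  sgraph_val :> {ffun V * V -> bool};
  sgraph_valP : sgraph_axiom sgraph_val }.

HB.instance Definition _ := [isSub for sgraph_val].
HB.instance Definition _ := [Equality of sgraph by <:].

Definition sedge (H : sgraph) (u v : V) : bool := H (u, v).

Lemma sedge_irr (H : sgraph) u : sedge H u u = false.
Proof. by have /andP[/forallP/(_ u)/negbTE] := sgraph_valP H. Qed.

Lemma sedge_sym (H : sgraph) u v : sedge H u v = sedge H v u.
Proof. by have /andP[_ /forallP/(_ u)/forallP/(_ v)/eqP] := sgraph_valP H. Qed.

Definition local_compl_val (H : sgraph) (u : V) : {ffun V * V -> bool} :=
  [ffun p => if [&& p.1 != p.2, sedge H u p.1 & sedge H u p.2]
             then ~~ sedge H p.1 p.2 else sedge H p.1 p.2].

Lemma local_compl_subproof H u : sgraph_axiom (local_compl_val H u).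
Proof.
apply/andP; split; first by apply/forallP=> v; rewrite ffunE /= eqxx sedge_irr.
apply/forallP=> v; apply/forallP=> w; rewrite !ffunE /=.
by rewrite [w == v]eq_sym (sedge_sym H w v) [sedge H u w && _]andbC.
Qed.

Definition local_compl (H : sgraph) (u : V) : sgraph :=
  SGraph (local_compl_subproof H u).

(* Local complementation is applicable at every vertex, so a sequence of such
   operations is just a sequence of vertices, performed from left to right. *)
Definition local_compls (H : sgraph) (phi : seq V) : sgraph :=
  foldl local_compl H phi.

End SimpleGraphs.

Section LoopedGraphs.
Variable V : finType.

Definition lgraph_axiom (a : {ffun V * V -> 'F_2}) : bool :=
  [forall u, forall v, a (u, v) == a (v, u)].

(* A graph with loops allowed is its adjacency matrix: a symmetric V x V matrix
   over F_2, with [u] looped iff the diagonal entry at [u] is 1. *)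
Record lgraph := LGraph {
  lgraph_val :> {ffun V * V -> 'F_2};
  lgraph_valP : lgraph_axiom lgraph_val }.

HB.instance Definition _ := [isSub for lgraph_val].
HB.instance Definition _ := [Equality of lgraph by <:].

Definition adj (G : lgraph) (u v : V) : 'F_2 := G (u, v).

Lemma adj_sym (G : lgraph) u v : adj G u v = adj G v u.
Proof. by have /forallP/(_ u)/forallP/(_ v)/eqP := lgraph_valP G. Qed.

Definition of_simple_val (H : sgraph V) : {ffun V * V -> 'F_2} :=
  [ffun p => (sedge H p.1 p.2)%:R].

Lemma of_simple_subproof H : lgraph_axiom (of_simple_val H).
Proof.
by apply/forallP=> u; apply/forallP=> v; rewrite !ffunE /= sedge_sym.
Qed.

Definition of_simple (H : sgraph V) : lgraph := LGraph (of_simple_subproof H).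

Definition remove_loops_val (G : lgraph) : {ffun V * V -> bool} :=
  [ffun p => (p.1 != p.2) && (adj G p.1 p.2 == 1)].

Lemma remove_loops_subproof G : sgraph_axiom (remove_loops_val G).
Proof.
apply/andP; split; first by apply/forallP=> u; rewrite ffunE /= eqxx.
by apply/forallP=> u; apply/forallP=> v; rewrite !ffunE /= (eq_sym u) adj_sym.
Qed.

Definition remove_loops (G : lgraph) : sgraph V :=
  SGraph (remove_loops_subproof G).

Definition loop_compl_val (G : lgraph) (X : {set V}) : {ffun V * V -> 'F_2} :=
  [ffun p => adj G p.1 p.2 + ((p.1 == p.2) && (p.1 \in X))%:R].

Lemma loop_compl_subproof G X : lgraph_axiom (loop_compl_val G X).
Proof.
apply/forallP=> u; apply/forallP=> v; rewrite !ffunE /= adj_sym (eq_sym u).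
by have [->|] := eqVneq v u.
Qed.

Definition loop_compl (G : lgraph) (X : {set V}) : lgraph :=
  LGraph (loop_compl_subproof G X).

(* Rows and columns of submatrices are numbered along [enum A] and [enum B]. *)
Definition adjsub (G : lgraph) (A B : {set V}) : 'M['F_2]_(#|A|, #|B|) :=
  \matrix_(i, j) adj G (enum_val i) (enum_val j).

Definition pivotable (G : lgraph) (X : {set V}) : bool :=
  \det (adjsub G X X) == 1.

(* The position of the vertex [u] in the enumeration of V that lists X first
   and then its complement. *)
Definition block_index (X : {set V}) (u : V) : 'I_(#|X| + #|~: X|) :=
  match boolP (u \in X) with
  | AltTrue uX => lshift #|~: X| (enum_rank_in uX u)
  | AltFalse uNX =>
      rshift #|X| (enum_rank_in (etrans (in_setC u X) uNX) u)
  end.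

Definition pivot_mx (G : lgraph) (X : {set V}) : 'M['F_2]_(#|X| + #|~: X|) :=
  let P := adjsub G X X in
  let Q := adjsub G X (~: X) in
  let R := adjsub G (~: X) X in
  let S := adjsub G (~: X) (~: X) in
  block_mx (invmx P)        (invmx P *m Q)
           (R *m invmx P)   (S + R *m invmx P *m Q).

Definition pivot_val (G : lgraph) (X : {set V}) : {ffun V * V -> 'F_2} :=
  [ffun p => pivot_mx G X (block_index X p.1) (block_index X p.2)].

Lemma adjsub_tr G A B : (adjsub G A B)^T = adjsub G B A.
Proof. by apply/matrixP=> i j; rewrite !mxE adj_sym. Qed.

Lemma pivot_mx_tr G X : (pivot_mx G X)^T = pivot_mx G X.
Proof.
rewrite /pivot_mx tr_block_mx linearD /= !trmx_mul !trmx_inv !adjsub_tr.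
by rewrite mulmxA.
Qed.

Lemma pivot_subproof G X : lgraph_axiom (pivot_val G X).
Proof.
apply/forallP=> u; apply/forallP=> v; rewrite !ffunE /=.
by rewrite -[in X in X == _]pivot_mx_tr mxE.
Qed.

(* Total by the convention for [invmx] on singular matrices; meaningful only
   under [pivotable G X], which says that the pivot is defined. *)
Definition pivot (G : lgraph) (X : {set V}) : lgraph :=
  LGraph (pivot_subproof G X).

End LoopedGraphs.

(* Main.v *)
Require Import Defs.
From mathcomp Require Import all_boot all_order all_algebra.
From mathcomp Require Import ring.

(* The graph {(x, A x)} of the adjacency matrix A of G lies in
   prod_(v in V) F_2^2, on which the product of the groups GL_2(F_2) acts
   coordinatewise.  Loop complementations, pivots, loop removals and local
   complementations all act on such subspaces by elements of this product
   (X by transvections, Y by coordinate swaps).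
   (1) The element M obtained for a sequence of local complementations can be
   reduced, modulo the stabiliser of "up to loops" on the left, to a coset
   representative in each coordinate, and there are three of them: identity,
   swap, and swap after a transvection, i.e. v outside Y, in Y minus X, in X.
   (2) If M maps the graph of H to that of H', induction on the number of
   coordinates in which the upper right entry b of M is nonzero shows that at
   most two local complementations lower this number; when it is 0, H = H'. *)

Set Implicit Arguments.
Unset Strict Implicit.
Unset Printing Implicit Defensive.
Import GRing.Theory.
Local Open Scope ring_scope.

(** * Arithmetic in the field with two elements *)

Lemma F2_cases (x : 'F_2) : x = 0 \/ x = 1.
Proof. by case: x => [[|[|//]]] ?; [left|right]; apply: val_inj. Qed.

Lemma F2_addxx (x : 'F_2) : x + x = 0.
Proof. by rewrite addrr_pchar2 // pchar_Fp. Qed.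

Lemma F2_neq0 (x : 'F_2) : (x != 0) = (x == 1).
Proof. by case: (F2_cases x) => ->. Qed.

Section LocalMaps.
Variable V : finType.
Implicit Types (G : lgraph V) (H : sgraph V) (X Y : {set V}).
Implicit Types (x y : {ffun V -> 'F_2}) (u v w : V).

(** * Adjacency operators and coordinatewise maps between their graphs *)

Definition adj_mul G x : {ffun V -> 'F_2} :=
  [ffun v => \sum_w adj G v w * x w].

Lemma adj_mulE G x v : adj_mul G x v = \sum_w adj G v w * x w.
Proof. exact: ffunE. Qed.

Lemma adj_mul_sub G x y : adj_mul G (x - y) = adj_mul G x - adj_mul G y.
Proof.
apply/ffunP=> v; rewrite !ffunE -sumrB; apply: eq_bigr => w _.
by rewrite !ffunE mulrBr.
Qed.

Lemma adj_mul0 G v : adj_mul G 0 v = 0.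
Proof. by rewrite adj_mulE big1 // => w _; rewrite ffunE mulr0. Qed.

Definition unit_vec u : {ffun V -> 'F_2} := [ffun v => (v == u)%:R].

Lemma adj_mul_unit G u v : adj_mul G (unit_vec u) v = adj G v u.
Proof.
rewrite ffunE (bigD1 u) //= ffunE eqxx mulr1 big1 ?addr0 // => w /negbTE wu.
by rewrite ffunE wu mulr0.
Qed.

(** First component of the image of (x, A x) under matrices with first rows ([a v], [b v]), where A
    is the adjacency matrix of [G]. *)
Definition frame_fst (a b : V -> 'F_2) G x : {ffun V -> 'F_2} :=
  [ffun v => a v * x v + b v * adj_mul G x v].

Lemma frame_fstE a b G x v :
  frame_fst a b G x v = a v * x v + b v * adj_mul G x v.
Proof. exact: ffunE. Qed.

(* The graph of G is mapped into the graph of G' (hence onto it) by the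
   matrices ((a v, b v), (c v, d v)) of GL_2(F_2). *)
Definition local_map (a b c d : V -> 'F_2) G G' : Prop :=
  (forall v, a v * d v + b v * c v = 1) /\
  (forall x v, adj_mul G' (frame_fst a b G x) v
               = c v * x v + d v * adj_mul G x v).

(** If the first component of the image of (z, A z) is 0, the second is A' 0 = 0, and invertible
    matrices send only 0 to 0. *)
Lemma frame_fst_inj a b c d G G' :
  local_map a b c d G G' -> injective (frame_fst a b G).
Proof.
move=> [det1 mapP] x y exy; apply/eqP; rewrite -subr_eq0; apply/eqP.
have z0 : frame_fst a b G (x - y) = 0.
  apply/ffunP=> v; rewrite [RHS]ffunE -(subrr (frame_fst a b G x v)) {2}exy.
  by rewrite [LHS]ffunE adj_mul_sub !ffunE; ring.
apply/ffunP=> v; rewrite [RHS]ffunE.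
have := mapP (x - y) v; rewrite z0 adj_mul0.
move/ffunP: z0 => /(_ v); rewrite ffunE [RHS]ffunE; have := det1 v.
move: ((x - y) v) (adj_mul _ _ v) (a v) (b v) (c v) (d v) => p q a' b' c' d'.
move=> det eab ecd; rewrite -[p]mul1r -det.
(* Cramer's rule without signs: the coefficient of [p] is the determinant, and [q] occurs twice. *)
transitivity (d' * (a' * p + b' * q) + b' * (c' * p + d' * q)
              - (b' * d' * q + b' * d' * q)); first ring.
by rewrite eab -ecd F2_addxx; ring.
Qed.

Lemma local_map_trans a b c d a' b' c' d' G G' G'' :
  local_map a b c d G G' -> local_map a' b' c' d' G' G'' ->
  local_map (fun v => a' v * a v + b' v * c v)
            (fun v => a' v * b v + b' v * d v)
            (fun v => c' v * a v + d' v * c v)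
            (fun v => c' v * b v + d' v * d v) G G''.
Proof.
move=> [det1 map1] [det2 map2]; split=> [v|x v].
  have := det2 v; have := det1 v.
  move: (a v) (b v) (c v) (d v) (a' v) (b' v) (c' v) (d' v).
  move=> p q r s p' q' r' s' e1 e2.
  (* Multiplicativity of the determinant: written with plus signs, it fails only by terms that occur
     twice. *)
  transitivity ((p * s + q * r) * (p' * s' + q' * r')
     + (p' * r' * p * q + p' * r' * p * q)
     + (q' * s' * r * s + q' * s' * r * s)); first ring.
  by rewrite e1 e2 !F2_addxx !addr0 mulr1.
have -> : frame_fst (fun v => a' v * a v + b' v * c v)
            (fun v => a' v * b v + b' v * d v) G x
          = frame_fst a' b' G' (frame_fst a b G x).
  by apply/ffunP=> w; rewrite !frame_fstE map1; ring.
by rewrite map2 map1 frame_fstE; ring.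
Qed.

(** * Changing loops *)

(** Adding diag(t) to A sends (x, A x) to (x, A x + t x), a transvection in each coordinate. *)
Lemma local_map_loops (t : V -> 'F_2) G G' :
  (forall u v, adj G' u v = adj G u v + (u == v)%:R * t u) ->
  local_map (fun=> 1) (fun=> 0) t (fun=> 1) G G'.
Proof.
move=> eG; split=> [v|x v]; first ring.
rewrite !adj_mulE.
rewrite (eq_bigr (fun w => adj G v w * x w + (v == w)%:R * t v * x w)); last first.
  by move=> w _; rewrite eG frame_fstE; ring.
rewrite big_split /= addrC mul1r; congr (_ + _).
rewrite (bigD1 v) //= eqxx big1 ?addr0 ?mul1r // => w /negbTE.
by rewrite eq_sym => ->; rewrite !mul0r.
Qed.

Lemma adj_loop_compl G X u v :
  adj (loop_compl G X) u v = adj G u v + (u == v)%:R * (u \in X)%:R.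
Proof. by rewrite [LHS]ffunE -natrM mulnb. Qed.

Lemma adj_of_simple H u v : adj (of_simple H) u v = (sedge H u v)%:R.
Proof. by rewrite [LHS]ffunE. Qed.

Lemma sedge_remove_loops G u v :
  sedge (remove_loops G) u v = (u != v) && (adj G u v == 1).
Proof. by rewrite [LHS]ffunE. Qed.

Lemma sgraphP H H' : (forall u v, sedge H u v = sedge H' u v) -> H = H'.
Proof. by move=> eH; apply/val_inj/ffunP => -[u v]; apply: eH. Qed.

Lemma of_simpleK H : remove_loops (of_simple H) = H.
Proof.
apply: sgraphP => u v; rewrite sedge_remove_loops adj_of_simple.
by have [->|_] := eqVneq u v; [rewrite sedge_irr | case: (sedge H u v)].
Qed.

Lemma adj_remove_loops G u v :
  adj (of_simple (remove_loops G)) u v = adj G u v + (u == v)%:R * adj G u u.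
Proof.
rewrite adj_of_simple sedge_remove_loops.
have [->|_] := eqVneq u v; first by rewrite mul1r F2_addxx.
by rewrite mul0r addr0; case: (F2_cases (adj G u v)) => ->.
Qed.

(* Invertible matrices with the same first row differ by a transvection, which
   only affects loops. *)
Lemma local_map_uniq a b c d c' d' G G' G'' :
  local_map a b c d G G' -> local_map a b c' d' G G'' ->
  remove_loops G' = remove_loops G''.
Proof.
move=> map1 map2; have [g gK Kg] := injF_bij (frame_fst_inj map1).
case: map1 map2 => [det1 map1] [det2 map2].
suff eG u v : u != v -> adj G' u v = adj G'' u v.
  apply: sgraphP => u v; rewrite !sedge_remove_loops.
  by have [//|/eG ->] := eqVneq u v.
(* Column [v] of both matrices is read off at the [x] whose first component is the unit vector at
   [v]. That component vanishes at [u], and on the kernel of the row ([a u], [b u]) the determinant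
   condition fixes the value of the second row. *)
move=> uv; rewrite -2!adj_mul_unit -(Kg (unit_vec v)); set x := g _.
rewrite map1 map2.
have: frame_fst a b G x u = 0 by rewrite /x Kg ffunE (negbTE uv).
rewrite ffunE; have := det1 u; have := det2 u.
move: (x u) (adj_mul _ _ u) (a u) (b u) (c u) (d u) (c' u) (d' u).
move=> p q a' b' c1 d1 c2 d2.
case: (F2_cases a') (F2_cases b') => -> [] ->;
  rewrite !(mul0r, mul1r, add0r, addr0) // => e2 e1 e0.
- by rewrite e1 e2 e0 !mulr0.
- by rewrite e1 e2 e0 !mulr0.
by move/eqP: e0; rewrite addr_eq0 oppr_pchar2 ?pchar_Fp // => /eqP ->;
   rewrite -!mulrDl ![_ + d1]addrC ![_ + d2]addrC e1 e2.
Qed.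

(** * Local complementation as a local map *)

Lemma sedge_local_compl H u v w :
  sedge (local_compl H u) v w
  = sedge H v w (+) [&& v != w, sedge H u v & sedge H u w].
Proof. by rewrite [LHS]ffunE /=; case: ifP => _; rewrite (addbT, addbF). Qed.

Lemma local_complK H u : local_compl (local_compl H u) u = H.
Proof.
apply: sgraphP => v w; rewrite !sedge_local_compl sedge_irr.
by rewrite !andbF !addbF -addbA addbb addbF.
Qed.

(** The matrix is ((1,1),(0,1)) at [u], ((1,0),(1,1)) at the neighbours of [u], and the identity
    elsewhere. *)
Lemma local_map_local_compl H u :
  local_map (fun=> 1) (fun v => (v == u)%:R) (fun v => (sedge H u v)%:R)
            (fun=> 1) (of_simple H) (of_simple (local_compl H u)).
Proof.
split=> [v|x v].
  by have [->|_] := eqVneq v u; rewrite ?sedge_irr /=; ring.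
set y := adj_mul _ x.
set x' := frame_fst _ _ _ _.
have x'E w : x' w = x w + (w == u)%:R * y u.
  by rewrite ffunE mul1r -/y; case: eqVneq => [->|]; rewrite ?mul0r.
have mulx' w : adj_mul (of_simple H) x' w = y w + (sedge H u w)%:R * y u.
  rewrite [LHS]adj_mulE [y w]adj_mulE.
  rewrite (eq_bigr (fun i => adj (of_simple H) w i * x i
      + adj (of_simple H) w i * (i == u)%:R * y u)); last first.
    by move=> i _; rewrite x'E; ring.
  rewrite big_split /=; congr (_ + _).
  rewrite (bigD1 u) //= big1 ?addr0; last first.
    by move=> i /negbTE ->; rewrite mulr0 mul0r.
  by rewrite eqxx mulr1 adj_of_simple sedge_sym.
(* With n the indicator of the neighbourhood of [u], the new adjacency matrix is A + n n^T +
   diag(n), where diag(n) cancels the loops created by n n^T; moreover n^T x' is the entry of A x'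
   at [u]. *)
have -> : adj_mul (of_simple (local_compl H u)) x' v =
  adj_mul (of_simple H) x' v + (sedge H u v)%:R * adj_mul (of_simple H) x' u
  + (sedge H u v)%:R * x' v.
  rewrite !adj_mulE mulr_sumr.
  have -> : (sedge H u v)%:R * x' v = \sum_w (v == w)%:R * (sedge H u v)%:R * x' w.
    rewrite (bigD1 v) //= eqxx mul1r big1 ?addr0 // => w /negbTE.
    by rewrite eq_sym => ->; rewrite !mul0r.
  rewrite -!big_split /=; apply: eq_bigr => w _; rewrite !adj_of_simple.
  rewrite sedge_local_compl mulrA -!mulrDl; congr (_ * _).
  by have [<-|_] /= := eqVneq v w; case: (sedge H v _) => //=;
     case: (sedge H u v) => //=; case: (sedge H u w) => //=; apply: val_inj.
rewrite !mulx' x'E sedge_irr mul0r addr0.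
have -> : (sedge H u v)%:R * (x v + (v == u)%:R * y u) = (sedge H u v)%:R * x v.
  by have [->|_] := eqVneq v u; rewrite ?sedge_irr /=; ring.
(* The term n_v y_u comes once from A x' and once from n n^T x'. *)
by rewrite -addrA -addrA [_ * y u + _]addrA F2_addxx add0r mul1r addrC.
Qed.

(** * Pivots as coordinate swaps *)

Lemma block_index_val X (i : 'I_#|X|) :
  block_index X (enum_val i) = lshift #|~: X| i.
Proof.
rewrite /block_index.
case: {-}_ / (boolP (enum_val i \in X)) => uX.
  by congr lshift; rewrite enum_valK_in.
by case/negP: (uX); apply: enum_valP.
Qed.

Lemma block_index_valC X (i : 'I_#|~: X|) :
  block_index X (enum_val i) = rshift #|X| i.
Proof.
rewrite /block_index.
case: {-}_ / (boolP (enum_val i \in X)) => uX; last first.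
  by congr rshift; rewrite enum_valK_in.
by have := enum_valP i; rewrite in_setC uX.
Qed.

Definition subcol (A : {set V}) x : 'cV['F_2]_#|A| := \col_i x (enum_val i).

Lemma subcol_inj A x y : subcol A x = subcol A y -> {in A, x =1 y}.
Proof.
move=> exy v vA; have /matrixP/(_ (enum_rank_in vA v) 0) := exy.
by rewrite !mxE enum_rankK_in.
Qed.

Lemma sum_setC_val X (F : V -> 'F_2) :
  \sum_w F w = \sum_(i < #|X|) F (enum_val i)
               + \sum_(i < #|~: X|) F (enum_val i).
Proof.
rewrite (bigID (mem X)) /= big_enum_val; congr (_ + _).
by rewrite -big_enum_val; apply: eq_bigl => w; rewrite in_setC.
Qed.

Lemma subcol_adj_mul G A X x :
  subcol A (adj_mul G x)
  = adjsub G A X *m subcol X x + adjsub G A (~: X) *m subcol (~: X) x.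
Proof.
apply/matrixP=> i j; rewrite !mxE adj_mulE (sum_setC_val X).
by congr (_ + _); apply: eq_bigr => w _; rewrite !mxE.
Qed.

Lemma subcol_pivot G X x :
  col_mx (subcol X (adj_mul (pivot G X) x)) (subcol (~: X) (adj_mul (pivot G X) x))
  = pivot_mx G X *m col_mx (subcol X x) (subcol (~: X) x).
Proof.
have pivotE k l : adj (pivot G X) k l
    = pivot_mx G X (block_index X k) (block_index X l) by exact: ffunE.
have mulE v : adj_mul (pivot G X) x v = (pivot_mx G X
    *m col_mx (subcol X x) (subcol (~: X) x)) (block_index X v) 0.
  rewrite adj_mulE (sum_setC_val X) [RHS]mxE big_split_ord /=.
  congr (_ + _); apply: eq_bigr => w _.
    by rewrite pivotE block_index_val col_mxEu [subcol _ _ _ _]mxE.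
  by rewrite pivotE block_index_valC col_mxEd [subcol _ _ _ _]mxE.
apply/matrixP=> i j; rewrite ord1.
case: (split_ordP i) => k ->.
  by rewrite col_mxEu mxE mulE block_index_val.
by rewrite col_mxEd mxE mulE block_index_valC.
Qed.

(** The pivot is the principal pivot transform: solving y = A x for the part of x on [Y] exchanges
    that part with the part of y on [Y]. *)
Lemma local_map_pivot G Y : pivotable G Y ->
  local_map (fun v => (v \notin Y)%:R) (fun v => (v \in Y)%:R)
            (fun v => (v \in Y)%:R) (fun v => (v \notin Y)%:R) G (pivot G Y).
Proof.
move=> /eqP detP; split=> [v|x].
  by case: (v \in Y); rewrite /= !(mulr0, mulr1, add0r, addr0).
set y := adj_mul G x; set x' := frame_fst _ _ _ _.
have Punit : adjsub G Y Y \in unitmx by rewrite unitmxE detP unitr1.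
have x'Y : subcol Y x' = subcol Y y.
  apply/matrixP=> i j; rewrite !mxE frame_fstE enum_valP /=.
  by rewrite mul0r mul1r add0r.
have x'C : subcol (~: Y) x' = subcol (~: Y) x.
  apply/matrixP=> i j; rewrite !mxE frame_fstE.
  have := enum_valP i; rewrite in_setC => /[dup] /negbTE -> ->.
  by rewrite mul0r mul1r addr0.
have := subcol_pivot G Y x'; rewrite x'Y x'C mul_block_col.
rewrite !(subcol_adj_mul G _ Y x) !mulmxDr -!mulmxA mulKmx // !mulmxDl.
(* [p] is P^-1 Q times the part of [x] outside [Y]. It occurs twice in the upper block, as does R
   [p] in the lower one. *)
set p := invmx _ *m (_ *m _).
have colxx n (z : 'cV['F_2]_n) : z + z = 0.
  by apply/matrixP=> i j; rewrite !mxE F2_addxx.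
rewrite -!mulmxA -/p -addrA colxx addr0 addrACA colxx addr0.
rewrite -subcol_adj_mul -/y => /eq_col_mx[eY eC] v.
case: (boolP (v \in Y)) => vY /=.
  by rewrite (subcol_inj eY vY) mul0r mul1r addr0.
by rewrite (subcol_inj eC) ?in_setC // mul0r mul1r add0r.
Qed.

(** A kernel vector of the block on [Y], extended by 0, has zero first component after the swap on
    [Y]; by injectivity it is 0. *)
Lemma local_map_pivotable G G' Y c d :
  local_map (fun v => (v \notin Y)%:R) (fun v => (v \in Y)%:R) c d G G' ->
  pivotable G Y.
Proof.
move=> mapG; rewrite /pivotable -F2_neq0; apply/det0P => -[r r0 rP].
pose z : {ffun V -> 'F_2} := [ffun v =>
  if boolP (v \in Y) is AltTrue vY then r 0 (enum_rank_in vY v) else 0].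
have zY : subcol Y z = r^T.
  apply/matrixP=> i j; rewrite ord1 !mxE ffunE.
  case: {-}_ / (boolP (enum_val i \in Y)) => iY; first by rewrite enum_valK_in.
  by case/negP: (iY); apply: enum_valP.
have zC v : v \notin Y -> z v = 0.
  move=> vNY; rewrite ffunE; case: {-}_ / (boolP (v \in Y)) => // vY.
  by case/negP: (vNY).
have zCol : subcol (~: Y) z = 0.
  apply/matrixP=> i j; rewrite !mxE zC //.
  by have := enum_valP i; rewrite in_setC.
have mulz : {in Y, adj_mul G z =1 (0 : {ffun V -> 'F_2})}.
  apply: subcol_inj; rewrite (subcol_adj_mul G _ Y) zY zCol mulmx0 addr0.
  rewrite -(trmxK (adjsub _ _ _)) -trmx_mul adjsub_tr rP.
  by apply/matrixP=> i j; rewrite !mxE ffunE.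
case/eqP: r0; apply: trmx_inj; rewrite -zY.
suff -> : z = 0 by apply/matrixP=> i j; rewrite !mxE ffunE.
apply: (frame_fst_inj mapG); apply/ffunP=> v; rewrite !frame_fstE.
have [vY|vY] /= := boolP (v \in Y).
  by rewrite mulz // adj_mul0 !mul0r ffunE.
by rewrite !mul0r !mul1r !addr0 zC // ffunE.
Qed.

(** * From sequences of local complementations to a single pivot *)

Lemma local_map_id G : local_map (fun=> 1) (fun=> 0) (fun=> 0) (fun=> 1) G G.
Proof. by apply: local_map_loops => u v; rewrite mulr0 addr0. Qed.

Lemma local_map_local_compls H phi :
  exists a b c d,
    local_map a b c d (of_simple H) (of_simple (local_compls H phi)).
Proof.
elim: phi H => [|u phi IH] H /=; first by do 4!eexists; apply: local_map_id.
have [a [b [c [d mapH]]]] := IH (local_compl H u).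
by do 4!eexists; apply: local_map_trans mapH; apply: local_map_local_compl.
Qed.

Lemma local_map_loop_compl G X :
  local_map (fun=> 1) (fun=> 0) (fun v => (v \in X)%:R) (fun=> 1)
            G (loop_compl G X).
Proof. by apply: local_map_loops => u v; apply: adj_loop_compl. Qed.

Lemma local_map_loop_complV G X :
  local_map (fun=> 1) (fun=> 0) (fun v => (v \in X)%:R) (fun=> 1)
            (loop_compl G X) G.
Proof.
apply: local_map_loops => u v.
by rewrite adj_loop_compl -addrA F2_addxx addr0.
Qed.

(** Up to loops only the first rows matter, and these are (1,0), (0,1) or (1,1): the cases outside
    [Y], in [Y] minus [X], and in [X]. *)
Lemma local_map_loops_pivot a b c d G G' :
  local_map a b c d G G' ->
  exists X Y, [/\ X \subset Y, pivotable (loop_compl G X) Y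
    & remove_loops G' = remove_loops (pivot (loop_compl G X) Y)].
Proof.
move=> mapG; pose Y := [set v | b v == 1].
pose X := [set v | (b v == 1) && (a v == 1)].
have XY : X \subset Y by apply/subsetP => v; rewrite !inE => /andP[].
(* Undoing the loop complementation first turns the rows (1,1) into (0,1), which leaves exactly the
   first rows of the swap on [Y]. *)
have := local_map_trans (local_map_loop_complV G X) mapG.
set d' := (X in local_map _ _ _ X); set c' := (X in local_map _ _ X).
set b' := (X in local_map _ X); set a' := (X in local_map X).
have eb : b' =1 (fun v => (v \in Y)%:R).
  move=> v; rewrite /b' inE mulr0 add0r mulr1.
  by case: (F2_cases (b v)) => ->.
have ea : a' =1 (fun v => (v \notin Y)%:R).
  move=> v; rewrite /a' !inE mulr1; have := mapG.1 v.
  case: (F2_cases (b v)) (F2_cases (a v)) => -> [] -> /=;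
    by rewrite ?mul0r ?addr0 ?add0r ?mul1r ?eqxx // => _; apply: val_inj.
move: a' b' c' d' ea eb => a' b' c' d' ea eb {}mapG.
have {}mapG : local_map (fun v => (v \notin Y)%:R) (fun v => (v \in Y)%:R)
    c' d' (loop_compl G X) G'.
  case: mapG => det1 mapG; split=> [v|x v]; first by rewrite -ea -eb; apply: det1.
  rewrite -mapG; congr (adj_mul _ _ _); apply/ffunP=> w.
  by rewrite !frame_fstE ea eb.
exists X, Y; split=> //; first exact: local_map_pivotable mapG.
apply: (local_map_uniq mapG (local_map_pivot _)).
exact: local_map_pivotable mapG.
Qed.

(** * From local maps to sequences of local complementations *)

Lemma local_map_equiv a b c d H H' :
  local_map a b c d (of_simple H) (of_simple H') ->
  exists phi, local_compls H phi = H'.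
Proof.
have [n] := ubnP #|[set v | b v == 1]|.
elim: n => // n IHn in a b c d H * => ltn mapH.
(* Local complementation is an involution, so prepending its local map gives a map from the
   complemented graph to [H']. *)
have step H1 : forall a1 b1 c1 d1 u,
  local_map a1 b1 c1 d1 (of_simple H1) (of_simple H') ->
  exists a2 b2 c2 d2,
  [/\ local_map a2 b2 c2 d2 (of_simple (local_compl H1 u)) (of_simple H'),
    forall v, a2 v = a1 v + b1 v * (sedge H1 u v)%:R
    & forall v, b2 v = b1 v + (v == u)%:R * a1 v].
  move=> a1 b1 c1 d1 u map1.
  have := local_map_local_compl (local_compl H1 u) u; rewrite local_complK.
  move=> /local_map_trans /(_ map1) map2; do 4!eexists; split; first exact: map2.
    move=> v /=; rewrite sedge_local_compl sedge_irr andbF addbF; ring.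
  by move=> v /=; ring.
(* Where the first row at [u] is (1,1), complementing at [u] clears [b1 u] and changes no other
   entry of [b1]. *)
have good (a1 b1 c1 d1 : V -> 'F_2) H1 u :
    (#|[set v | (b1 v == 1)%R]| <= n)%N ->
    local_map a1 b1 c1 d1 (of_simple H1) (of_simple H') ->
    a1 u = 1 -> b1 u = 1 -> exists phi, local_compls H1 phi = H'.
  move=> len map1 au bu.
  have [a2 [b2 [c2 [d2 [map2 _ eb]]]]] := step _ _ _ _ _ u map1.
  have [|phi <-] := IHn _ _ _ _ _ _ map2; last by exists (u :: phi).
  apply: leq_trans len; apply: proper_card; apply/properP; split.
    apply/subsetP => v; rewrite !inE eb; have [->|_] := eqVneq v u.
      by rewrite bu.
    by rewrite mul0r addr0.
  by exists u; rewrite !inE ?bu // eb bu au eqxx mulr1 F2_addxx.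
have [b0|] := eqVneq [set v | b v == 1] set0.
  exists [::]; rewrite /= -[LHS]of_simpleK -[RHS]of_simpleK.
  have eb v : b v = 0.
    move/setP: b0 => /(_ v); rewrite !inE.
    by case: (F2_cases (b v)) => ->.
  have ea v : a v = 1.
    have := mapH.1 v; rewrite eb mul0r addr0.
    by case: (F2_cases (a v)) => -> //; rewrite mul0r.
  (* All first rows are (1,0), as for the identity map of [H], so [H] and [H'] agree up to loops. *)
  have mapH' : local_map a b (fun=> 0) (fun=> 1) (of_simple H) (of_simple H).
    split=> [v|x v]; first by rewrite ea; ring.
    rewrite mul0r add0r mul1r; congr (adj_mul _ _ _); apply/ffunP=> w.
    by rewrite frame_fstE ea eb; ring.
  exact: local_map_uniq mapH' mapH.
case/set0Pn => u; rewrite inE => /eqP bu.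
case: (F2_cases (a u)) => au; last exact: good mapH au bu.
(* Otherwise the unit vector at u would be mapped to 0. *)
have [v /andP[uv /eqP bv]|none] := pickP (fun v => sedge H u v && (b v == 1)).
  case: (F2_cases (a v)) => av; last exact: good mapH av bv.
  (* Since [a u] is 0, complementing at [u] leaves [b] unchanged, while it turns the row (0,1) at
     the neighbour [v] into (1,1). *)
  have [a2 [b2 [c2 [d2 [map2 ea eb]]]]] := step _ _ _ _ _ u mapH.
  have [|||phi <-] := good _ _ _ _ _ v _ map2; last by exists (u :: phi).
  - move: ltn; rewrite ltnS; congr (_ <= n)%N.
    apply: eq_card => w; rewrite !inE eb.
    by have [->|] := eqVneq w u; rewrite ?au ?mulr0 ?mul0r ?addr0.
  - by rewrite ea av bv uv mulr1 add0r.
  rewrite eb bv; have [evu|] := eqVneq v u; last by rewrite mul0r addr0.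
  by rewrite evu sedge_irr in uv.
suff /(frame_fst_inj mapH)/ffunP/(_ u) : frame_fst a b (of_simple H) (unit_vec u)
    = frame_fst a b (of_simple H) 0.
  by rewrite !ffunE eqxx.
apply/ffunP=> v; rewrite !frame_fstE adj_mul0 adj_mul_unit adj_of_simple sedge_sym.
have -> : b v * (sedge H u v)%:R = 0.
  have := none v; case: (sedge H u v) => /=; last by rewrite mulr0.
  by case: (F2_cases (b v)) => ->; rewrite ?mul0r.
rewrite !ffunE; have [->|_] := eqVneq v u; last by rewrite /=; ring.
by rewrite au; ring.
Qed.
End LocalMaps.

(** * Both directions, by composing local maps *)

Theorem theorem27 (V : finType) :
  (forall (H : sgraph V) (phi : seq V),
     exists X Y : {set V},
       [/\ X \subset Y,
           pivotable (loop_compl (of_simple H) X) Y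
         & local_compls H phi
           = remove_loops (pivot (loop_compl (of_simple H) X) Y)])
  /\
  (forall (G : lgraph V) (X Y : {set V}),
     pivotable (loop_compl G X) Y ->
     exists phi : seq V,
       local_compls (remove_loops G) phi
       = remove_loops (pivot (loop_compl G X) Y)).
Proof.
split=> [H phi|G X Y pivG].
  have [a [b [c [d /local_map_loops_pivot[X [Y [XY pivH eH]]]]]]] :=
    local_map_local_compls H phi.
  by exists X, Y; split=> //; rewrite -eH of_simpleK.
have map1 : local_map (fun=> 1) (fun=> 0) (fun v => adj G v v) (fun=> 1)
    (of_simple (remove_loops G)) G.
  apply: local_map_loops => u v.
  have [->|uv] := eqVneq u v; rewrite adj_remove_loops ?eqxx ?(negbTE uv).
    by rewrite mul1r F2_addxx add0r.
  by rewrite !mul0r !addr0.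
(* The chain restores the loops of [G], complements loops on [X] and pivots on [Y]; removing loops
   then ends in a simple graph. *)
have map2 := local_map_trans (local_map_trans map1 (local_map_loop_compl G X))
               (local_map_pivot pivG).
apply: local_map_equiv (local_map_trans map2 (local_map_loops _)).
exact: adj_remove_loops.
Qed.
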